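(* Let $A$ be a finite dimensional, local, commutative $k$-algebra with maximal ideal $\mathfrak m$ such that $a^p=0$ for all $a\in\mathfrak m$. Assume that $A$ is equipped with two coproducts $\Delta,\Delta':A\to A\otimes A$ with the property that $$\Delta(a)-a\otimes1-1\otimes a,\quad \Delta'(a)-a\otimes1-1\otimes a\ \in\ \mathfrak m\otimes\mathfrak m\qquad\text{for all } a\in\mathfrak m.$$ Let $M,M'$ be $A$-modules and let $M\boxtimes M'$ be the $A\otimes A$-module given as the external tensor product. Then for any flat map $\alpha:k[t]/t^p\to A$, the pull-back of $M\boxtimes M'$ via $\Delta\circ\alpha$ is a projective $k[t]/t^p$-module if and only if the pull-back of $M\boxtimes M'$ via $\Delta'\circ\alpha$ is a projective $k[t]/t^p$-module. More generally, let $H$ be a finite dimensional, local, commutative Hopf algebra over $k$ with coproduct $\Delta_H$ and maximal ideal $\mathfrak m_H$ such that $c^p=0$ for all $c\in\mathfrak m_H$, and equip $A\otimes H$ with the coproducts $\Delta\otimes\Delta_H$ and $\Delta'\otimes\Delta_H$. Let $M,M'$ be $(A\otimes H)$-modules and let $M\boxtimes M'$ denote the $(A\otimes H)\otimes(A\otimes H)$-module given as the external tensor product. Then for any flat map $\alpha:k[t]/t^p\to A\otimes H$, the pull-back of $M\boxtimes M'$ via $(\Delta\otimes\Delta_H)\circ\alpha$ is a projective $k[t]/t^p$-module if and only if the pull-back of $M\boxtimes M'$ via $(\Delta'\otimes\Delta_H)\circ\alpha$ is a projective $k[t]/t^p$-module.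
   Context: $k$ is a field of characteristic $p>0$; tensor products are over $k$. Coproducts $\Delta,\Delta'$ are homomorphisms of $k$-algebras. A flat map $\alpha:k[t]/t^p\to B$ is a $k$-algebra homomorphism making $B$ a flat $k[t]/t^p$-module. The external tensor product $M\boxtimes M'$ is $M\otimes M'$ with $(a\otimes a')(m\otimes m')=am\otimes a'm'$. The coproduct $\Delta\otimes\Delta_H$ on $A\otimes H$ is the tensor product coproduct, i.e. $\Delta\otimes\Delta_H$ followed by the interchange of the middle two factors, $A\otimes A\otimes H\otimes H\simeq (A\otimes H)\otimes(A\otimes H)$.
   Formalization: In the second part (with H) it is assumed that A = k + 𝔪, i.e. the residue field of A is k; this is automatic if the coproduct on A has a counit, and without it the claim fails when coproducts are merely algebra homomorphisms. *)

(* Defs.v *)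
From HB Require Import structures.
From mathcomp Require Import all_boot all_order all_algebra.
From mathcomp Require Import ring_quotient qpoly falgebra.
From mathcomp Require Import boolp.

Set Implicit Arguments.
Unset Strict Implicit.
Unset Printing Implicit Defensive.

Import GRing.Theory.
Local Open Scope ring_scope.
Local Open Scope quotient_scope.

Reserved Notation "u *t v" (at level 40, left associativity).
Reserved Notation "U ⊗ V" (at level 40, left associativity).
Reserved Notation "M ⊠ N" (at level 40, left associativity).

Section TensorDef.
Variables (R : comNzRingType) (U V : lmodType R).

(* The list [:: (u1, v1); ...; (un, vn)] stands for the sum of the ui ⊗ vi.   *)
(* Every element of U ⊗_R V has this form since a (u ⊗ v) = (a u) ⊗ v, so     *)
(* U ⊗_R V is the commutative monoid of such formal sums modulo the           *)
(* congruence generated by the usual relations; inverses exist because        *)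
(* u ⊗ v + (- u) ⊗ v = 0 ⊗ v = 0.                                             *)
Inductive tens_rel : seq (U * V) -> seq (U * V) -> Prop :=
| TensRefl s : tens_rel s s
| TensSym s t : tens_rel s t -> tens_rel t s
| TensTrans s t r : tens_rel s t -> tens_rel t r -> tens_rel s r
| TensCat s s' t t' : tens_rel s s' -> tens_rel t t' ->
    tens_rel (s ++ t) (s' ++ t')
| TensCatC s t : tens_rel (s ++ t) (t ++ s)
| TensAddl u u' v : tens_rel [:: (u + u', v)] [:: (u, v); (u', v)]
| TensAddr u v v' : tens_rel [:: (u, v + v')] [:: (u, v); (u, v')]
| TensScale a u v : tens_rel [:: (a *: u, v)] [:: (u, a *: v)]
| TensZero v : tens_rel [:: (0, v)] [::].

Definition tens_relb : rel (seq (U * V)) := fun s t => `[< tens_rel s t >].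

Lemma tens_relb_refl : reflexive tens_relb.
Proof. by move=> s; apply/asboolP; constructor. Qed.

Lemma tens_relb_sym : symmetric tens_relb.
Proof. by move=> s t; apply/asboolP/asboolP; apply: TensSym. Qed.

Lemma tens_relb_trans : transitive tens_relb.
Proof.
by move=> t s r /asboolP st /asboolP tr; apply/asboolP; apply: TensTrans tr.
Qed.

Canonical tens_equiv :=
  EquivRel tens_relb tens_relb_refl tens_relb_sym tens_relb_trans.

Definition tens := {eq_quot tens_equiv}.
HB.instance Definition _ := Choice.on tens.

Definition mktens (s : seq (U * V)) : tens := \pi_({eq_quot tens_equiv}) s.

Lemma mktensP s t : mktens s = mktens t <-> tens_rel s t.
Proof.
by rewrite /mktens; split=> [/eqmodP/asboolP | st];
  last by apply/eqmodP/asboolP.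
Qed.

Lemma mktens_repr (x : tens) : mktens (repr (x : {eq_quot tens_equiv})) = x.
Proof. exact: reprK. Qed.

Lemma tens_rel_repr s :
  tens_rel (repr (mktens s : {eq_quot tens_equiv})) s.
Proof. by apply/mktensP; rewrite mktens_repr. Qed.

Definition tens_rep (x : tens) : seq (U * V) := repr (x : {eq_quot tens_equiv}).

Definition tens_add (x y : tens) := mktens (tens_rep x ++ tens_rep y).
Definition tens_opp (x : tens) :=
  mktens [seq (- p.1, p.2) | p <- tens_rep x].
Definition tens_scale (a : R) (x : tens) :=
  mktens [seq (a *: p.1, p.2) | p <- tens_rep x].

Lemma tens_rel_map (f : U -> U) s t :
    {morph f : u v / u + v} -> (forall a, {morph f : u / a *: u}) ->
  tens_rel s t ->
  tens_rel [seq (f p.1, p.2) | p <- s] [seq (f p.1, p.2) | p <- t].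
Proof.
move=> fD fZ; elim=> {s t} /=.
- by move=> s; apply: TensRefl.
- by move=> s t _; apply: TensSym.
- by move=> s t r _ st _; apply: TensTrans.
- by move=> s s' t t' _ ss' _ tt'; rewrite !map_cat; apply: TensCat.
- by move=> s t; rewrite !map_cat; apply: TensCatC.
- by move=> u u' v; rewrite fD; apply: TensAddl.
- by move=> u v v'; apply: TensAddr.
- by move=> a u v; rewrite fZ; apply: TensScale.
- move=> v; rewrite (_ : f 0 = 0); first exact: TensZero.
  by rewrite -(scale0r (0 : U)) fZ !scale0r.
Qed.

Lemma mktens_cat s t : tens_add (mktens s) (mktens t) = mktens (s ++ t).
Proof. by apply/mktensP; apply: TensCat; apply: tens_rel_repr. Qed.

Lemma mktens_scale a s :
  tens_scale a (mktens s) = mktens [seq (a *: p.1, p.2) | p <- s].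
Proof.
apply/mktensP; apply: tens_rel_map (tens_rel_repr _).
  exact: scalerDr.
by move=> b u; rewrite !scalerA mulrC.
Qed.

Lemma mktens_opp s :
  tens_opp (mktens s) = mktens [seq (- p.1, p.2) | p <- s].
Proof.
apply/mktensP; apply: tens_rel_map (tens_rel_repr _).
  exact: opprD.
by move=> b u; rewrite scalerN.
Qed.

Lemma tens_addA : associative tens_add.
Proof.
move=> x y z; rewrite -[x]mktens_repr -[y]mktens_repr -[z]mktens_repr.
by rewrite !mktens_cat catA.
Qed.

Lemma tens_addC : commutative tens_add.
Proof.
move=> x y; rewrite -[x]mktens_repr -[y]mktens_repr !mktens_cat.
by apply/mktensP; apply: TensCatC.
Qed.

Lemma tens_add0 : left_id (mktens [::]) tens_add.
Proof. by move=> x; rewrite -[x]mktens_repr mktens_cat. Qed.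

Lemma mktens_cons p s : mktens (p :: s) = tens_add (mktens [:: p]) (mktens s).
Proof. by rewrite mktens_cat. Qed.

Lemma tens_addN : left_inverse (mktens [::]) tens_opp tens_add.
Proof.
move=> x; rewrite -[x]mktens_repr mktens_opp.
elim: (repr _) => [|[u v] s IHs] /=; first by rewrite mktens_cat.
rewrite mktens_cons [mktens ((u, v) :: s)]mktens_cons.
set s' := mktens (map _ s) in IHs *.
rewrite -tens_addA [tens_add s' _]tens_addC -tens_addA.
rewrite [tens_add (mktens s) s']tens_addC IHs tens_addA mktens_cat.
rewrite mktens_cat cats0; apply/mktensP.
apply: TensTrans (TensSym (TensAddl _ _ _)) _.
by rewrite addNr; apply: TensZero.
Qed.

HB.instance Definition _ :=
  GRing.isZmodule.Build tens tens_addA tens_addC tens_add0 tens_addN.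

Lemma tens_scaleA a b x : tens_scale a (tens_scale b x) = tens_scale (a * b) x.
Proof.
rewrite -[x]mktens_repr !mktens_scale -map_comp.
by congr mktens; apply: eq_map => p /=; rewrite scalerA.
Qed.

Lemma tens_scale1 : left_id 1 tens_scale.
Proof.
move=> x; rewrite -[x]mktens_repr mktens_scale -[in RHS](map_id (repr _)).
by congr mktens; apply: eq_map => -[u v] /=; rewrite scale1r.
Qed.

Lemma tens_scaleDr : right_distributive tens_scale +%R.
Proof.
move=> a x y; rewrite -[x]mktens_repr -[y]mktens_repr.
by rewrite [_ + _]mktens_cat !mktens_scale [RHS]mktens_cat map_cat.
Qed.

Lemma tens_scaleDl x : {morph tens_scale^~ x : a b / a + b}.
Proof.
move=> a b; rewrite -[x]mktens_repr !mktens_scale.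
elim: (repr _) => [|[u v] s IHs] /=; first by rewrite [RHS]mktens_cat.
rewrite [LHS]mktens_cons IHs [X in _ = X + _]mktens_cons.
rewrite [X in _ = _ + X]mktens_cons.
set sa := mktens (map _ s); set sb := mktens (map _ s).
rewrite [RHS](addrACA (mktens _) sa (mktens _) sb); congr (_ + _).
by rewrite [RHS]mktens_cat; apply/mktensP; rewrite scalerDl; apply: TensAddl.
Qed.

HB.instance Definition _ := GRing.Zmodule_isLmodule.Build R tens
  tens_scaleA tens_scale1 tens_scaleDr tens_scaleDl.

Definition ptens (u : U) (v : V) : tens := mktens [:: (u, v)].

Lemma mktensE s : mktens s = \sum_(p <- s) ptens p.1 p.2.
Proof.
elim: s => [|[u v] s IHs]; first by rewrite big_nil.
by rewrite big_cons -IHs mktens_cons.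
Qed.

Lemma ptensDl u u' v : ptens (u + u') v = ptens u v + ptens u' v.
Proof. by rewrite [RHS]mktens_cat; apply/mktensP; apply: TensAddl. Qed.

Lemma ptensDr u v v' : ptens u (v + v') = ptens u v + ptens u v'.
Proof. by rewrite [RHS]mktens_cat; apply/mktensP; apply: TensAddr. Qed.

Lemma ptensZl a u v : ptens (a *: u) v = a *: ptens u v.
Proof. by rewrite [RHS]mktens_scale. Qed.

Lemma ptensZr a u v : ptens u (a *: v) = a *: ptens u v.
Proof. by rewrite -ptensZl; apply/mktensP; apply: TensSym (TensScale _ _ _). Qed.

Lemma tens_ind (P : tens -> Prop) :
    (forall u v, P (ptens u v)) -> (forall x y, P x -> P y -> P (x + y)) ->
  forall x, P x.
Proof.
move=> Pp PD x; rewrite -[x]mktens_repr mktensE.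
elim: (repr _) => [|p s IHs]; last by rewrite big_cons; apply: PD.
by rewrite big_nil -(scale0r (ptens 0 0)) -ptensZl.
Qed.

End TensorDef.

Notation "U ⊗ V" := (tens U V) : type_scope.
Notation "u *t v" := (ptens u v) : ring_scope.

Definition bilin (R : comNzRingType) (U V W : lmodType R) (f : U -> V -> W) :=
  (forall u, linear (f u)) /\ (forall v, linear (f^~ v)).

Section Bilin.
Variables (R : comNzRingType) (U V W : lmodType R) (f : U -> V -> W).
Hypothesis f_bilin : bilin f.

Lemma bilinDl u u' v : f (u + u') v = f u v + f u' v.
Proof. by have := f_bilin.2 v 1 u u'; rewrite /= !scale1r. Qed.

Lemma bilinDr u v v' : f u (v + v') = f u v + f u v'.
Proof. by have := f_bilin.1 u 1 v v'; rewrite !scale1r. Qed.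

Lemma bilin0l v : f 0 v = 0.
Proof. by apply: (@addrI _ (f 0 v)); rewrite -bilinDl !addr0. Qed.

Lemma bilin0r u : f u 0 = 0.
Proof. by apply: (@addrI _ (f u 0)); rewrite -bilinDr !addr0. Qed.

Lemma bilinZl a u v : f (a *: u) v = a *: f u v.
Proof. by have := f_bilin.2 v a u 0; rewrite /= bilin0l !addr0. Qed.

Lemma bilinZr a u v : f u (a *: v) = a *: f u v.
Proof. by have := f_bilin.1 u a v 0; rewrite /= bilin0r !addr0. Qed.

End Bilin.

Lemma bilin_ptens (R : comNzRingType) (U V : lmodType R) : bilin (@ptens R U V).
Proof.
split=> [u a v v' | v a u u']; first by rewrite ptensDr ptensZr.
by rewrite ptensDl ptensZl.
Qed.

Section TensorLift.
Variables (R : comNzRingType) (U V W : lmodType R) (f : U -> V -> W).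

(* For bilinear f, the linear map u ⊗ v |-> f u v; it depends on the choice   *)
(* of representatives when f is not bilinear.                                 *)
Definition tlift (x : U ⊗ V) : W := \sum_(p <- tens_rep x) f p.1 p.2.

Hypothesis f_bilin : bilin f.

Lemma tlift_mk s : tlift (mktens s) = \sum_(p <- s) f p.1 p.2.
Proof.
suff sumE t r : tens_rel t r ->
    \sum_(p <- t) f p.1 p.2 = \sum_(p <- r) f p.1 p.2.
  exact/sumE/tens_rel_repr.
elim=> {t r} //=.
- by move=> t r r' _ -> _ ->.
- by move=> t t' r r' _ tt' _ rr'; rewrite !big_cat /= tt' rr'.
- by move=> t r; rewrite !big_cat /= addrC.
- by move=> u u' v; rewrite !big_cons !big_nil (bilinDl f_bilin) !addr0.
- by move=> u v v'; rewrite !big_cons !big_nil (bilinDr f_bilin) !addr0.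
- by move=> a u v; rewrite !big_cons !big_nil (bilinZl f_bilin) (bilinZr f_bilin).
- by move=> v; rewrite big_cons !big_nil (bilin0l f_bilin) addr0.
Qed.

Lemma tliftE u v : tlift (u *t v) = f u v.
Proof. by rewrite tlift_mk big_cons big_nil addr0. Qed.

Lemma tlift_is_linear : linear tlift.
Proof.
move=> a x y; rewrite -[x]mktens_repr -[y]mktens_repr.
rewrite [_ *: _]mktens_scale [_ + _]mktens_cat !tlift_mk big_cat big_map /=.
congr (_ + _); rewrite scaler_sumr; apply: eq_bigr => p _ /=.
by rewrite (bilinZl f_bilin).
Qed.

End TensorLift.

Section TensorBilinear.
Variables (R : comNzRingType).

Lemma ptens_is_linear (U V : lmodType R) (u : U) : linear (@ptens R U V u).
Proof. exact: (bilin_ptens U V).1. Qed.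

HB.instance Definition _ (U V : lmodType R) (u : U) :=
  GRing.isLinear.Build R V (U ⊗ V) _ (ptens u) (ptens_is_linear u).

Lemma ptens_suml (U V : lmodType R) I (r : seq I) (F : I -> U) (v : V) :
  (\sum_(i <- r) F i) *t v = \sum_(i <- r) F i *t v.
Proof.
elim: r => [|i r IHr]; last by rewrite !big_cons ptensDl IHr.
by rewrite !big_nil -(scale0r 0) ptensZl scale0r.
Qed.

Lemma tlift_eq_lin (U V W : lmodType R) (g h : U ⊗ V -> W) :
    linear g -> linear h -> (forall u v, g (u *t v) = h (u *t v)) -> g =1 h.
Proof.
move=> gL hL gh; have add (e : U ⊗ V -> W) : linear e -> {morph e : x y / x + y}.
  by move=> eL x y; have := eL 1 x y; rewrite !scale1r.
by elim/tens_ind => // x y gx gy; rewrite (add g) // (add h) // gx gy.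
Qed.

Lemma bilin_tlift (U V X Y : lmodType R) (f : X -> U -> V -> Y) :
    (forall x, bilin (f x)) -> (forall u v, linear (fun x => f x u v)) ->
  bilin (fun x => tlift (f x)).
Proof.
move=> fb fL; split=> [x | t]; first exact: tlift_is_linear.
move=> a x y; rewrite -[t]mktens_repr !tlift_mk // scaler_sumr -big_split /=.
by apply: eq_bigr => p _; rewrite fL.
Qed.

Lemma bilin_flip (U V W : lmodType R) (f : U -> V -> W) :
  bilin f -> bilin (fun v u => f u v).
Proof. by case. Qed.

(* The bilinear map (a ⊗ b, u ⊗ v) |-> f a u ⊗ g b v.                         *)
Definition tens2 (A B U V U' V' : lmodType R) (f : A -> U -> U')
    (g : B -> V -> V') (x : A ⊗ B) (y : U ⊗ V) : U' ⊗ V' :=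
  tlift (fun a b => tlift (fun u v => f a u *t g b v) y) x.

Section Tens2.
Variables (A B U V U' V' : lmodType R) (f : A -> U -> U') (g : B -> V -> V').
Hypotheses (fb : bilin f) (gb : bilin g).

Let bilin_in a b : bilin (fun u v => f a u *t g b v).
Proof.
split=> [u c v v' | v c u u'].
  by rewrite (gb.1 b) (bilin_ptens _ _).1.
by rewrite (fb.1 a) ptensDl ptensZl.
Qed.

Let bilin_out y : bilin (fun a b => tlift (fun u v => f a u *t g b v) y).
Proof.
split=> [a | b] c x x'; rewrite -[y]mktens_repr !tlift_mk // scaler_sumr.
  rewrite -big_split /=; apply: eq_bigr => p _.
  by rewrite (gb.2 _ c) (bilin_ptens _ _).1.
rewrite -big_split /=; apply: eq_bigr => p _.
by rewrite (fb.2 _ c) ptensDl ptensZl.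
Qed.

Lemma tens2E a b u v : tens2 f g (a *t b) (u *t v) = f a u *t g b v.
Proof. by rewrite /tens2 (tliftE (bilin_out _)) tliftE. Qed.

Lemma bilin_tens2 : bilin (tens2 f g).
Proof.
split=> [x | y]; last exact: tlift_is_linear.
move=> c y y'; rewrite -[x]mktens_repr /tens2 !(tlift_mk (bilin_out _)).
rewrite scaler_sumr -big_split /=; apply: eq_bigr => p _.
by rewrite tlift_is_linear.
Qed.

End Tens2.

Definition tens_map (U V U' V' : lmodType R) (f : {linear U -> U'})
    (g : {linear V -> V'}) : U ⊗ V -> U' ⊗ V' :=
  tlift (fun u v => f u *t g v).

Section TensMap.
Variables (U V U' V' : lmodType R).
Variables (f : {linear U -> U'}) (g : {linear V -> V'}).

Lemma bilin_map : bilin (fun u v => f u *t g v).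
Proof.
split=> [u c v v' | v c u u'].
  by rewrite linearP (bilin_ptens _ _).1.
by rewrite linearP ptensDl ptensZl.
Qed.

Lemma tens_mapE u v : tens_map f g (u *t v) = f u *t g v.
Proof. by rewrite /tens_map (tliftE bilin_map). Qed.

Lemma tens_map_is_linear : linear (tens_map f g).
Proof. exact: (tlift_is_linear bilin_map). Qed.

HB.instance Definition _ := GRing.isLinear.Build R (U ⊗ V) (U' ⊗ V') _
  (tens_map f g) tens_map_is_linear.

End TensMap.

Definition tassoc (U V W : lmodType R) : (U ⊗ V) ⊗ W -> U ⊗ (V ⊗ W) :=
  tlift (fun x w => tlift (fun u v => u *t (v *t w)) x).

Lemma tassocE (U V W : lmodType R) (u : U) (v : V) (w : W) :
  tassoc ((u *t v) *t w) = u *t (v *t w).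
Proof.
have b1 (w' : W) : bilin (fun (u : U) (v : V) => u *t (v *t w')).
  split=> [u' c v1 v2 | v' c u1 u2]; last by rewrite ptensDl ptensZl.
  by rewrite ptensDl ptensZl ptensDr ptensZr.
have b2 : bilin (fun (w : W) x => tlift (fun (u : U) (v : V) => u *t (v *t w)) x).
  apply: (bilin_tlift b1) => u' v' c w1 w2.
  by rewrite ptensDr ptensZr ptensDr ptensZr.
by rewrite /tassoc (tliftE (bilin_flip b2)) tliftE.
Qed.

(* The interchange (a ⊗ a') ⊗ (b ⊗ b') |-> (a ⊗ b) ⊗ (a' ⊗ b').               *)
Definition tinterchange (U U' V V' : lmodType R) :
    (U ⊗ U') ⊗ (V ⊗ V') -> (U ⊗ V) ⊗ (U' ⊗ V') :=
  tlift (tens2 (@ptens R U V) (@ptens R U' V')).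

Lemma tinterchangeE (U U' V V' : lmodType R) u u' v v' :
  @tinterchange U U' V V' ((u *t u') *t (v *t v')) = (u *t v) *t (u' *t v').
Proof.
rewrite /tinterchange tliftE; last by apply: bilin_tens2; apply: bilin_ptens.
by rewrite tens2E //; apply: bilin_ptens.
Qed.

Lemma tinterchange_is_linear (U U' V V' : lmodType R) :
  linear (@tinterchange U U' V V').
Proof. by apply: tlift_is_linear; apply: bilin_tens2; apply: bilin_ptens. Qed.

HB.instance Definition _ (U U' V V' : lmodType R) :=
  GRing.isLinear.Build R _ _ _ (@tinterchange U U' V V')
    (@tinterchange_is_linear U U' V V').

End TensorBilinear.

Section TensorVect.
Import VectorInternalTheory.
Variables (k : fieldType) (U V : vectType k).
Local Notation m := (dim U).
Local Notation n := (dim V).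

Definition tens_mx : U ⊗ V -> 'M[k]_(m, n) :=
  tlift (fun (u : U) (v : V) => (v2r u)^T *m v2r v).

Definition mx_tens (M : 'M[k]_(m, n)) : U ⊗ V :=
  \sum_i \sum_j M i j *: (r2v (delta_mx 0 i) *t r2v (delta_mx 0 j)).

Lemma tens_mx_bilin : bilin (fun (u : U) (v : V) => (v2r u)^T *m v2r v).
Proof.
split=> [u c v v' | v c u u'].
  by rewrite linearP /= mulmxDr -scalemxAr.
by rewrite linearP /= linearP /= mulmxDl -scalemxAl.
Qed.

Lemma tens_mx_is_linear : linear tens_mx.
Proof. exact: tlift_is_linear tens_mx_bilin. Qed.

Lemma mx_tens_is_linear : linear mx_tens.
Proof.
move=> c M N; rewrite /mx_tens scaler_sumr -big_split /=; apply: eq_bigr => i _.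
rewrite scaler_sumr -big_split /=; apply: eq_bigr => j _.
by rewrite !mxE scalerDl scalerA.
Qed.

HB.instance Definition _ := GRing.isLinear.Build k _ _ _ tens_mx
  tens_mx_is_linear.
HB.instance Definition _ := GRing.isLinear.Build k _ _ _ mx_tens
  mx_tens_is_linear.

Lemma tens_mxE (u : U) (v : V) : tens_mx (u *t v) = (v2r u)^T *m v2r v.
Proof. exact: tliftE tens_mx_bilin _ _. Qed.

Lemma tens_mxK : cancel tens_mx mx_tens.
Proof.
apply: (@tlift_eq_lin _ _ _ _ (mx_tens \o tens_mx) idfun) => //=.
  by move=> c x y /=; rewrite !linearP.
move=> u v; rewrite tens_mxE /mx_tens.
have sumE (W : vectType k) (w : W) :
    w = \sum_i v2r w 0 i *: r2v (delta_mx 0 i).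
  rewrite -{1}[w]v2rK {1}(row_sum_delta (v2r w)) linear_sum.
  by apply: eq_bigr => i _; rewrite linearZ.
rewrite [in RHS](sumE _ u) [in RHS](sumE _ v) ptens_suml.
apply: eq_bigr => i _; rewrite linear_sum /=; apply: eq_bigr => j _.
rewrite linearZ /= ptensZl scalerA; congr (_ *: _).
by rewrite mxE big_ord1 !mxE mulrC.
Qed.

Lemma mx_tensK : cancel mx_tens tens_mx.
Proof.
move=> M; rewrite /mx_tens linear_sum [RHS]matrix_sum_delta.
apply: eq_bigr => i _; rewrite linear_sum; apply: eq_bigr => j _.
rewrite linearZ /= tens_mxE !r2vK; congr (_ *: _).
by rewrite trmx_delta mul_delta_mx.
Qed.

Lemma tens_vect_axiom : Vector.axiom (m * n) (U ⊗ V).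
Proof.
exists (mxvec \o tens_mx); first by move=> c x y /=; rewrite !linearP.
by apply: bij_comp; [exists vec_mx; [apply: mxvecK | apply: vec_mxK]
                   | exists mx_tens; [apply: tens_mxK | apply: mx_tensK]].
Qed.

HB.instance Definition _ :=
  Lmodule_hasFinDim.Build k (U ⊗ V) tens_vect_axiom.

Lemma ptens_neq0 (u : U) (v : V) : u != 0 -> v != 0 -> u *t v != 0.
Proof.
move=> u0 v0; apply/eqP => /(congr1 tens_mx); rewrite tens_mxE linear0.
move/matrixP => uv0.
have nz (W : vectType k) (w : W) : w != 0 -> exists i, v2r w 0 i != 0.
  move=> w0; apply/rV0Pn; apply: contra w0 => /eqP w0.
  by rewrite -[w]v2rK w0 linear0.
have [i ui] := nz _ _ u0; have [j vj] := nz _ _ v0.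
have := uv0 i j; rewrite !mxE big_ord1 mxE => /eqP.
by rewrite mulf_eq0 (negPf ui) (negPf vj).
Qed.

End TensorVect.

Section TensorAlgebra.
Variables (k : fieldType) (A B : falgType k).

Lemma bilin_mul (C : algType k) : bilin (@GRing.mul C).
Proof.
split=> [a c b b' | b c a a']; first by rewrite mulrDr scalerAr.
by rewrite mulrDl scalerAl.
Qed.

Definition tens_mul : A ⊗ B -> A ⊗ B -> A ⊗ B :=
  tens2 (@GRing.mul A) (@GRing.mul B).

Lemma tens_mul_bilin : bilin tens_mul.
Proof. by apply: bilin_tens2; apply: bilin_mul. Qed.

Lemma tens_mulE a b a' b' :
  tens_mul (a *t b) (a' *t b') = (a * a') *t (b * b').
Proof. by rewrite /tens_mul tens2E //; apply: bilin_mul. Qed.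

Lemma tens_mulDl : left_distributive tens_mul +%R.
Proof. by move=> x y z; apply: (bilinDl tens_mul_bilin). Qed.

Lemma tens_mulDr : right_distributive tens_mul +%R.
Proof. by move=> x y z; apply: (bilinDr tens_mul_bilin). Qed.

Lemma tens_mulA : associative tens_mul.
Proof.
move=> x y z; elim/tens_ind: x => [a b | x x' IH IH']; last first.
  by rewrite !tens_mulDl IH IH'.
elim/tens_ind: y => [a' b' | y y' IH IH']; last first.
  by rewrite !(tens_mulDl, tens_mulDr) IH IH'.
elim/tens_ind: z => [a'' b'' | z z' IH IH']; last first.
  by rewrite !tens_mulDr IH IH'.
by rewrite !tens_mulE !mulrA.
Qed.

Lemma tens_mul1l : left_id (1 *t 1) tens_mul.
Proof.
elim/tens_ind=> [a b | x y IHx IHy]; first by rewrite tens_mulE !mul1r.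
by rewrite tens_mulDr IHx IHy.
Qed.

Lemma tens_mul1r : right_id (1 *t 1) tens_mul.
Proof.
elim/tens_ind=> [a b | x y IHx IHy]; first by rewrite tens_mulE !mulr1.
by rewrite tens_mulDl IHx IHy.
Qed.

Lemma tens_oner_neq0 : 1 *t 1 != 0 :> A ⊗ B.
Proof. by apply: ptens_neq0; apply: oner_neq0. Qed.

HB.instance Definition _ := GRing.Zmodule_isNzRing.Build (A ⊗ B)
  tens_mulA tens_mul1l tens_mul1r tens_mulDl tens_mulDr tens_oner_neq0.

Lemma tens_scaleAl c (x y : A ⊗ B) : c *: (x * y) = (c *: x) * y.
Proof. exact/esym/(bilinZl tens_mul_bilin). Qed.

HB.instance Definition _ := GRing.Lmodule_isLalgebra.Build k (A ⊗ B) tens_scaleAl.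

Lemma tens_scaleAr c (x y : A ⊗ B) : c *: (x * y) = x * (c *: y).
Proof. exact/esym/(bilinZr tens_mul_bilin). Qed.

HB.instance Definition _ := GRing.Lalgebra_isAlgebra.Build k (A ⊗ B) tens_scaleAr.
HB.instance Definition _ := Algebra_isFalgebra.Build k (A ⊗ B).

Lemma ptensM (a a' : A) (b b' : B) :
  (a *t b) * (a' *t b') = (a * a') *t (b * b').
Proof. exact: tens_mulE. Qed.

End TensorAlgebra.

Section TensorAlgebraMorphisms.
Variable k : fieldType.

Lemma tens_map_is_monoid_morphism (A B A' B' : falgType k)
    (f : {lrmorphism A -> A'}) (g : {lrmorphism B -> B'}) :
  monoid_morphism (tens_map f g).
Proof.
split=> [|x y]; first by rewrite tens_mapE !rmorph1.
elim/tens_ind: x => [a b | x x' IH IH']; last first.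
  by rewrite mulrDl !linearD /= mulrDl IH IH'.
elim/tens_ind: y => [a' b' | y y' IH IH']; last first.
  by rewrite mulrDr !linearD /= mulrDr IH IH'.
by rewrite ptensM !tens_mapE ptensM !rmorphM.
Qed.

HB.instance Definition _ (A B A' B' : falgType k)
    (f : {lrmorphism A -> A'}) (g : {lrmorphism B -> B'}) :=
  GRing.isMonoidMorphism.Build (A ⊗ B) (A' ⊗ B') (tens_map f g)
    (tens_map_is_monoid_morphism f g).

Lemma tinterchange_is_monoid_morphism (A A' B B' : falgType k) :
  monoid_morphism (@tinterchange k A A' B B').
Proof.
split=> [|x y]; first by rewrite tinterchangeE.
elim/tens_ind: x => [u v | x x' IH IH']; last first.
  by rewrite mulrDl !linearD /= mulrDl IH IH'.
elim/tens_ind: y => [w z | y y' IH IH']; last first.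
  by rewrite mulrDr !linearD /= mulrDr IH IH'.
elim/tens_ind: u => [a a' | x x' IH IH']; last first.
  by rewrite ptensDl mulrDl !linearD /= mulrDl IH IH'.
elim/tens_ind: w => [c c' | x x' IH IH']; last first.
  by rewrite ptensDl mulrDr !linearD /= mulrDr IH IH'.
elim/tens_ind: v => [b b' | x x' IH IH']; last first.
  by rewrite ptensDr mulrDl !linearD /= mulrDl IH IH'.
elim/tens_ind: z => [d d' | x x' IH IH']; last first.
  by rewrite ptensDr mulrDr !linearD /= mulrDr IH IH'.
by rewrite !ptensM !tinterchangeE !ptensM.
Qed.

HB.instance Definition _ (A A' B B' : falgType k) :=
  GRing.isMonoidMorphism.Build ((A ⊗ A') ⊗ (B ⊗ B')) ((A ⊗ B) ⊗ (A' ⊗ B'))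
    (@tinterchange k A A' B B') (@tinterchange_is_monoid_morphism A A' B B').

End TensorAlgebraMorphisms.

Definition tens_coprod (k : fieldType) (A H : falgType k)
    (D : {lrmorphism A -> A ⊗ A}) (DH : {lrmorphism H -> H ⊗ H}) :
    {lrmorphism A ⊗ H -> (A ⊗ H) ⊗ (A ⊗ H)} :=
  @tinterchange k A A H H \o tens_map D DH.

Definition pullback (R S : pzRingType) (f : {rmorphism R -> S})
  (N : lmodType S) : Type := N.

Section Pullback.
Variables (R S : pzRingType) (f : {rmorphism R -> S}) (N : lmodType S).

HB.instance Definition _ := GRing.Zmodule.on (pullback f N).

Definition pullback_scale (r : R) (x : pullback f N) : pullback f N :=
  (f r *: (x : N)).

Lemma pullback_scaleA a b x :
  pullback_scale a (pullback_scale b x) = pullback_scale (a * b) x.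
Proof. by rewrite /pullback_scale scalerA rmorphM. Qed.

Lemma pullback_scale1 : left_id 1 pullback_scale.
Proof. by move=> x; rewrite /pullback_scale rmorph1 scale1r. Qed.

Lemma pullback_scaleDr : right_distributive pullback_scale +%R.
Proof. by move=> a x y; rewrite /pullback_scale scalerDr. Qed.

Lemma pullback_scaleDl x : {morph pullback_scale^~ x : a b / a + b}.
Proof. by move=> a b; rewrite /pullback_scale rmorphD scalerDl. Qed.

HB.instance Definition _ := GRing.Zmodule_isLmodule.Build R (pullback f N)
  pullback_scaleA pullback_scale1 pullback_scaleDr pullback_scaleDl.

End Pullback.

(* The tensor product is taken over k, through the structure maps k -> A and  *)
(* k -> B; the alias carries the (A ⊗ B)-module structure.                    *)
Definition boxtens (k : fieldType) (A B : falgType k) (M : lmodType A)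
    (N : lmodType B) : Type :=
  (pullback (in_alg A) M : lmodType k) ⊗ (pullback (in_alg B) N : lmodType k).

Section BoxTens.
Variables (k : fieldType) (A B : falgType k) (M : lmodType A) (N : lmodType B).

HB.instance Definition _ := GRing.Zmodule.on (boxtens M N).

Lemma bilin_scale (C : falgType k) (L : lmodType C) :
  bilin (fun (c : C) (x : pullback (in_alg C) L) =>
    (c *: (x : L) : pullback (in_alg C) L)).
Proof.
split=> [c a x y | x a c d] /=.
  by rewrite scalerDr; congr (_ + _);
    rewrite [LHS]scalerA [RHS]scalerA /= -scalerAr -scalerAl mulr1 mul1r.
rewrite scalerDl; congr (_ + _).
by rewrite [RHS]scalerA /= -scalerAl mul1r.
Qed.

Definition boxtens_scale : A ⊗ B -> boxtens M N -> boxtens M N :=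
  tens2 (fun (a : A) (x : pullback (in_alg A) M) =>
           (a *: (x : M) : pullback (in_alg A) M))
        (fun (b : B) (y : pullback (in_alg B) N) =>
           (b *: (y : N) : pullback (in_alg B) N)).

Definition pbox (x : M) (y : N) : boxtens M N :=
  (x : pullback (in_alg A) M) *t (y : pullback (in_alg B) N).

Lemma boxtens_scale_pure a b x y :
  boxtens_scale (a *t b) (pbox x y) = pbox (a *: x) (b *: y).
Proof. by rewrite /boxtens_scale tens2E //; apply: bilin_scale. Qed.

Lemma boxtens_scale_bilin :
  @bilin k (A ⊗ B) (pullback (in_alg A) M ⊗ pullback (in_alg B) N)
    (pullback (in_alg A) M ⊗ pullback (in_alg B) N) boxtens_scale.
Proof. by apply: bilin_tens2; apply: bilin_scale. Qed.

Lemma boxtens_scaleDr : right_distributive boxtens_scale +%R.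
Proof. by move=> a x y; apply: (bilinDr boxtens_scale_bilin). Qed.

Lemma boxtens_scaleDl x : {morph boxtens_scale^~ x : a b / a + b}.
Proof. by move=> a b; apply: (bilinDl boxtens_scale_bilin). Qed.

Lemma boxtens_ind (P : boxtens M N -> Prop) :
    (forall x y, P (pbox x y)) -> (forall u v, P u -> P v -> P (u + v)) ->
  forall u, P u.
Proof.
exact: (@tens_ind k (pullback (in_alg A) M) (pullback (in_alg B) N)).
Qed.

Lemma boxtens_scaleA a b x :
  boxtens_scale a (boxtens_scale b x) = boxtens_scale (a * b) x.
Proof.
elim/boxtens_ind: x => [x y | x y IHx IHy]; last first.
  by rewrite !boxtens_scaleDr IHx IHy.
elim/tens_ind: a => [a a' | a a' IH IH']; last first.
  by rewrite mulrDl !boxtens_scaleDl IH IH'.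
elim/tens_ind: b => [b b' | b b' IH IH']; last first.
  by rewrite mulrDr !boxtens_scaleDl boxtens_scaleDr IH IH'.
by rewrite ptensM !boxtens_scale_pure !scalerA.
Qed.

Lemma boxtens_scale1 : left_id 1 boxtens_scale.
Proof.
elim/boxtens_ind=> [x y | x y IHx IHy].
  by rewrite boxtens_scale_pure !scale1r.
by rewrite boxtens_scaleDr IHx IHy.
Qed.

HB.instance Definition _ := GRing.Zmodule_isLmodule.Build (A ⊗ B) (boxtens M N)
  boxtens_scaleA boxtens_scale1 boxtens_scaleDr boxtens_scaleDl.

Lemma boxtens_scaleE (a : A) (b : B) (x : M) (y : N) :
  (a *t b) *: pbox x y = pbox (a *: x) (b *: y).
Proof. exact: boxtens_scale_pure. Qed.

End BoxTens.

Notation "M ⊠ N" := (boxtens M N) : type_scope.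

(* Neither finitely generated nor finite dimensional modules are assumed.     *)
Definition projective (R : pzRingType) (P : lmodType R) : Prop :=
  forall (N Q : lmodType R) (g : {linear N -> Q}) (f : {linear P -> Q}),
    (forall q, exists n, g n = q) ->
  exists h : {linear P -> N}, forall x, g (h x) = f x.

Definition flat (R : comNzRingType) (B : lmodType R) : Prop :=
  forall (N N' : lmodType R) (f : {linear N -> N'}),
    injective f -> injective (@tens_map R B N B N' idfun f).

Notation truncpoly k p := {poly %/ ('X^p : {poly k})}.

(* B^o is B as a left module over itself.                                      *)
Definition flat_map (k : fieldType) (p : nat) (B : falgType k)
    (alpha : {lrmorphism truncpoly k p -> B}) : Prop :=
  flat (pullback alpha B^o).

Section Local.
Variables (k : fieldType) (A : falgType k).

(* idealr_closed describes a proper left ideal, so these notions are meant for *)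
(* commutative A; classically every subset of A is given by some {pred A}.     *)
Definition maximal_ideal (I : {pred A}) : Prop :=
  idealr_closed I /\
  forall J : {pred A}, idealr_closed J -> {subset I <= J} -> {subset J <= I}.

Definition local_with (m : {pred A}) : Prop :=
  maximal_ideal m /\ forall J : {pred A}, maximal_ideal J -> J =i m.

(* A = k + m, i.e. the residue field of A is k. This is automatic when a       *)
(* coproduct on A has a counit eps : A -> k, since then ker eps = m.           *)
Definition trivial_residue_field (m : {pred A}) : Prop :=
  forall a : A, exists c : k, a - c%:A \in m.

(* The image of m ⊗ n in A ⊗ A.                                               *)
Definition in_tens (m n : {pred A}) (x : A ⊗ A) : Prop :=
  exists s : seq (A * A),
    all (fun ab => (ab.1 \in m) && (ab.2 \in n)) s /\
    x = \sum_(ab <- s) ab.1 *t ab.2.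

End Local.

Record hopf (k : fieldType) (H : falgType k) := Hopf {
  hopf_coprod : {lrmorphism H -> H ⊗ H};
  hopf_counit : {lrmorphism H -> k | *%R};
  hopf_antipode : {linear H -> H};
  hopf_coassoc : forall c,
    tassoc (tens_map hopf_coprod idfun (hopf_coprod c)) =
    tens_map idfun hopf_coprod (hopf_coprod c);
  hopf_counitl : forall c,
    tlift (fun a b : H => hopf_counit a *: b) (hopf_coprod c) = c;
  hopf_counitr : forall c,
    tlift (fun a b : H => hopf_counit b *: a) (hopf_coprod c) = c;
  hopf_antipodel : forall c,
    tlift (fun a b : H => hopf_antipode a * b) (hopf_coprod c) =
    (hopf_counit c)%:A;
  hopf_antipoder : forall c,
    tlift (fun a b : H => a * hopf_antipode b) (hopf_coprod c) =
    (hopf_counit c)%:A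
}.

(* Main.v *)
Require Import Defs.
From HB Require Import structures.
From mathcomp Require Import all_boot all_order all_algebra.
From mathcomp Require Import ring_quotient qpoly falgebra.
From mathcomp Require Import boolp classical_sets.
From mathcomp Require Import ring.

Set Implicit Arguments.
Unset Strict Implicit.
Unset Printing Implicit Defensive.

Import GRing.Theory.
Local Open Scope ring_scope.

(** Let T = k[t]/t^p.  The two pulled-back modules are one vector space N on which
t acts as x and as y, where x and y are the images of alpha(t) under the two
coproducts.  The proof compares these two commuting p-nilpotent operators.

Projectivity is first turned into an exactness condition.  A T-module, of any
dimension, is projective exactly when ker t lies in t^(p-1) N
([projective_acyclic], [acyclic_projective]).  A projective module is a retract
of the induced module T ⊗ N, where the condition is read off from coefficients.
Conversely, the sum of t^i phi t^(p-1-i) is T-linear for every k-linear phi;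
such transfers turn k-linear lifts, which exist by Zorn's lemma
([linear_choice]), into T-linear ones.

The difference of x and y is a sum of products a b with a^p = b^p = 0.  Indeed
the two coproducts differ on m by elements of m ⊗ m, and
u ⊗ v = (u ⊗ 1)(1 ⊗ v); after tensoring with H the factors become
(u ⊗ h) ⊗ 1 and 1 ⊗ (v ⊗ h'), whose p-th powers vanish since u^p = v^p = 0.
For A itself alpha(t) lies in m because it is nilpotent; for A ⊗ H the equality
A = k + m reduces to the case of first factors in m, the coproducts agreeing on
scalars.

So it suffices to replace x by y = x + a b, for commuting p-nilpotent x, a, b,
without losing ker x = x^(p-1) N.  The heart of the matter is [ker_perturb]:
ker y lies in y^(p-1) N + b ker y.  Iterating p times kills the second summand
([acyclic_perturb]). *)

(** * Perturbing a p-nilpotent operator by a product *)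

(** For x^p = 0 this is exactness of the 2-periodic complex with differentials x
and x^(p-1): exactness at ker x gives exactness at ker x^(p-1), see
[acyclic_ker_exp]. *)
Definition acyclic (p : nat) (B : pzRingType) (N : lmodType B) (x : B) : Prop :=
  forall n : N, x *: n = 0 -> exists w : N, n = x ^+ p.-1 *: w.

Section Perturbation.
Variables (p : nat) (B : comNzRingType).
Hypothesis pcharB : p \in [pchar B].

Let p_gt0 : (0 < p)%N. Proof. exact: prime_gt0 (pcharf_prime pcharB). Qed.

(** Pascal's rule at row p, whose inner entries vanish, makes consecutive entries
of row p - 1 opposite. *)
Lemma bin_pred_pchar i : (i < p)%N -> 'C(p.-1, i)%:R = (-1) ^+ i :> B.
Proof.
elim: i => [|i IHi] ip; first by rewrite bin0.
have := binS p.-1 i; rewrite prednK // => /(congr1 (fun n => n%:R : B)).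
have /dvdnP[c ->] : (p %| 'C(p, i.+1))%N.
  by apply: prime_dvd_bin; rewrite ?(pcharf_prime pcharB) ?ip.
rewrite natrM (pcharf0 pcharB) mulr0 natrD IHi ?(ltnW ip) // => /eqP.
by rewrite eq_sym addr_eq0 exprS mulN1r => /eqP.
Qed.

(** This is (y - x)^p = y^p - x^p divided by y - x, obtained from the binomial
coefficients since y - x may be a zero divisor. *)
Lemma exprB_pred_pchar (x y : B) :
  (y - x) ^+ p.-1 = \sum_(i < p.-1.+1) y ^+ (p.-1 - i) * x ^+ i.
Proof.
rewrite exprBn; apply: eq_bigr => i _.
rewrite -mulr_natr bin_pred_pchar -?[X in (_ < X)%N](prednK p_gt0) //.
rewrite mulrC !mulrA -exprD addnn -mul2n exprM.
by rewrite sqrrN !expr1n mul1r.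
Qed.

Lemma acyclic_ker_exp (N : lmodType B) (x : B) : acyclic p N x ->
  forall n : N, x ^+ p.-1 *: n = 0 -> exists w, n = x *: w.
Proof.
move=> xP; suff H j (n : N) : (j < p)%N -> x ^+ j *: n = 0 -> exists w, n = x *: w.
  by move=> n; apply: H; rewrite prednK.
elim: j n => [|j IHj] n jp.
  by rewrite scale1r => ->; exists 0; rewrite scaler0.
rewrite exprS -scalerA => /xP[w]; have -> : p.-1 = (j + (p.-1 - j.+1).+1)%N.
  by rewrite addnS -addSn subnKC // -ltnS prednK.
rewrite exprD -scalerA => /eqP; rewrite -subr_eq0 -scalerBr => /eqP.
move=> /(IHj _ (ltnW jp))[v /eqP]; rewrite subr_eq exprS => /eqP ->.
by exists (v + x ^+ (p.-1 - j.+1) *: w); rewrite scalerDr scalerA.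
Qed.

(** Let y = x + c with c = a b, and let q be the divided difference
(y^(p-1) - x^(p-1)) / c.  For n in ker y, x n = - c n, so x^(p-1) kills a n, as
a c^(p-1) contains a^p; hence a n = x n1.  Then x (n + b n1) = 0, so that
n + b n1 = x^(p-1) n2 = y^(p-1) n2 - b a q n2.  The candidate
v = - n1 - a q n2 satisfies y v = - a (x^(p-1) + q y) n2, and
x^(p-1) + q y = c^(p-1) in characteristic p, so y v = - a^p b^(p-1) n2 = 0. *)
Lemma ker_perturb (N : lmodType B) (x a b : B) :
    x ^+ p = 0 -> a ^+ p = 0 -> acyclic p N x ->
  forall n : N, (x + a * b) *: n = 0 ->
  exists w v : N, n = (x + a * b) ^+ p.-1 *: w + b *: v /\ (x + a * b) *: v = 0.
Proof.
move=> xp ap xP n; set c := a * b; set y := x + c => yn.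
have xn : x *: n = - (c *: n).
  by apply/eqP; rewrite -addr_eq0 -scalerDl; apply/eqP.
have [n1 an] : exists n1, a *: n = x *: n1.
  apply: (acyclic_ker_exp xP); rewrite scalerA mulrC -scalerA.
  have -> j : x ^+ j *: n = (- c) ^+ j *: n.
    elim: j => [//|j IHj]; rewrite exprSr -scalerA xn scalerN scalerA mulrC.
    by rewrite -scalerA IHj exprS -scalerA scaleNr.
  rewrite scalerA (_ : a * _ = a ^+ p * (- b) ^+ p.-1).
    by rewrite ap mul0r scale0r.
  by rewrite /c -mulrN exprMn mulrA -exprS prednK.
have [n2 n2E] : exists n2, n + b *: n1 = x ^+ p.-1 *: n2.
  apply: xP; rewrite scalerDr xn (_ : x *: (b *: n1) = c *: n) ?addNr //.
  by rewrite scalerA [x * b]mulrC -[LHS]scalerA -an scalerA [b * a]mulrC.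
pose q := \sum_(i < p.-1) y ^+ (p.-1.-1 - i) * x ^+ i.
have cE : c = y - x by rewrite /y [x + c]addrC addrK.
have yq : y ^+ p.-1 = x ^+ p.-1 + c * q.
  by rewrite -[y ^+ _](subrK (x ^+ p.-1)) subrXX -cE addrC.
have cq : c ^+ p.-1 = q * y + x ^+ p.-1.
  rewrite [in LHS]cE exprB_pred_pchar big_ord_recr /= subnn mul1r.
  congr (_ + _); rewrite mulr_suml; apply: eq_bigr => i _.
  rewrite mulrAC -exprSr; congr (y ^+ _ * _).
  by rewrite -(predn_sub p.-1) prednK ?subn_gt0.
exists n2, (- n1 - (a * q) *: n2); split.
  rewrite yq scalerDl -n2E scalerBr scalerN scalerA mulrA [b * a]mulrC.
  by rewrite addrACA addrK subrr addr0.
have yn1 : y *: n1 = a *: (x ^+ p.-1 *: n2).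
  by rewrite -n2E scalerDr an scalerDl scalerA.
rewrite scalerBr scalerN yn1 !scalerA -opprD -scalerDl.
rewrite (_ : _ + _ = a * c ^+ p.-1); last by rewrite cq; ring.
by rewrite /c exprMn mulrA -exprS prednK // ap mul0r scale0r oppr0.
Qed.

Lemma acyclic_perturb (N : lmodType B) (x a b : B) :
    x ^+ p = 0 -> a ^+ p = 0 -> b ^+ p = 0 ->
  acyclic p N x -> acyclic p N (x + a * b).
Proof.
move=> xp ap bp xP n yn; set y := x + a * b in yn *.
suff iter j : exists w v, n = y ^+ p.-1 *: w + b ^+ j *: v /\ y *: v = 0.
  by have [w [v [-> _]]] := iter p; exists w; rewrite bp scale0r addr0.
elim: j => [|j [w [v [-> yv]]]].
  by exists 0, n; rewrite scaler0 add0r scale1r.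
have [w' [v' [-> yv']]] := ker_perturb xp ap xP yv.
exists (w + b ^+ j *: w'), v'; split=> //.
by rewrite !scalerDr !scalerA addrA exprSr [y ^+ _ * _]mulrC.
Qed.

End Perturbation.

(** * Linear choice over a field *)

Section LinearChoice.
Variables (k : fieldType) (V W : lmodType k) (R : V -> W -> Prop).
Hypothesis R_lin : forall c v w v' w',
  R v w -> R v' w' -> R (c *: v + v') (c *: w + w').

Local Open Scope classical_set_scope.

(* Graphs of linear maps with subspace domain, compatible with R on the part of
   the domain where R has a solution. *)
Let partial (A : set (V * W)) : Prop :=
  [/\ A (0, 0),
      forall c x y, A x -> A y -> A (c *: x.1 + y.1, c *: x.2 + y.2),
      forall w, A (0, w) -> w = 0 &
      forall v w w', A (v, w) -> R v w' -> R v w].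

Let partialB A v w v' w' c : partial A -> A (v, w) -> A (v', w') ->
  A (v' - c *: v, w' - c *: w).
Proof.
case=> _ Alin _ _ Av Av'; have /= := Alin (- c) _ _ Av Av'.
by rewrite !scaleNr [- _ + _]addrC [X in (_, X)]addrC.
Qed.

(* If some v + v1 with v1 in the domain is R-related to some w0, then w0 minus the
   image of v1 is a possible image of v, and compatibility propagates by
   linearity; otherwise any image will do. *)
Let extend A v : partial A -> (forall w, ~ A (v, w)) ->
  exists B, partial B /\ A `<` B.
Proof.
move=> PA Av; have [A0 Alin Afun AR] := PA.
have [w wP] : exists w, forall c v' w' u,
    A (v', w') -> R (c *: v + v') u -> R (c *: v + v') (c *: w + w').
  have [[v1 [w1 [w0 [A1 R1]]]]|none] :=
      pselect (exists v1 w1 w0, A (v1, w1) /\ R (v + v1) w0).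
    exists (w0 - w1) => c v' w' u A' Ru.
    have A'' := partialB c PA A1 A'.
    have Ru' := R_lin (- c) R1 Ru.
    have vE : - c *: (v + v1) + (c *: v + v') = v' - c *: v1.
      by rewrite scaleNr scalerDr opprD addrACA addNr add0r addrC.
    rewrite vE in Ru'; have := R_lin c R1 (AR _ _ _ A'' Ru').
    by rewrite !scalerBr scalerDr addrACA subrr addr0 [w' - _]addrC addrA.
  exists 0 => c v' w' u A' Ru; rewrite scaler0 add0r.
  have [c0|c0] := eqVneq c 0.
    by move: Ru; rewrite c0 scale0r add0r; apply: AR.
  case: none; exists (c^-1 *: v'), (c^-1 *: w'), (c^-1 *: u).
  split; first by have := Alin c^-1 _ _ A' A0; rewrite /= !addr0.
  have := R_lin (c^-1 - 1) Ru Ru.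
  by rewrite !scalerBl !scale1r !subrK scalerDr scalerA mulVf // scale1r.
exists [set x | exists c y, A y /\ x = (c *: v + y.1, c *: w + y.2)].
split; last first.
  split=> [[v' w'] A' | sub]; first by exists 0, (v', w'); rewrite !scale0r !add0r.
  by apply: (Av w); apply: sub; exists 1, (0, 0); rewrite !scale1r !addr0.
split=> /=.
- by exists 0, (0, 0); rewrite !scale0r !addr0.
- move=> c _ _ [d [y [Ay ->]]] [e [z [Az ->]]] /=.
  exists (c * d + e), (c *: y.1 + z.1, c *: y.2 + z.2); split; first exact: Alin.
  by congr (_, _); rewrite /= scalerDr scalerDl scalerA addrACA.
- move=> w' [c [[v1 w1] [A1 [/esym/eqP v0 ->]]]] /=.
  have [c0|c0] := eqVneq c 0.
    move: v0 A1; rewrite c0 !scale0r !add0r => /eqP /= -> ; exact: Afun.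
  case: (Av (- (c^-1 *: w1))); have := partialB c^-1 PA A1 A0.
  rewrite !sub0r; move: v0; rewrite addrC addr_eq0 => /eqP /= ->.
  by rewrite scalerN opprK scalerA mulVf // scale1r.
- move=> v' w' u [c [[v1 w1] [A1 [-> ->]]]] /=; exact: wP A1.
Qed.

(** Both the k-linear sections of surjections and the k-linear extensions of maps
given on a subspace are instances, R being the graph of the conditions to meet;
vectors that R relates to nothing are unconstrained. *)
Lemma linear_choice :
  exists f : {linear V -> W}, forall v w, R v w -> R v (f v).
Proof.
have [A [PA Amax]] : exists A, (A = set0 \/ partial A) /\
    forall B, A `<` B -> ~ (B = set0 \/ partial B).
  (* The union of the empty chain does not contain (0, 0), whence the case of the
     empty set. *)
  apply: (@Zorn_bigcup _ (fun A => A = set0 \/ partial A)) => F FP Ftot.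
  have [[X FX PX]|none] := pselect (exists2 X, F X & partial X); last first.
    left; apply/seteqP; split=> // x [X FX Xx].
    by have [X0|PX] := FP X FX; [rewrite -X0 | case: none; exists X].
  have FPx Y y : F Y -> Y y -> partial Y.
    by move=> FY Yy; have [Y0|//] := FP Y FY; rewrite Y0 in Yy.
  right; split.
  - by exists X => //; case: PX.
  - move=> c x y [Y FY Yx] [Z FZ Zy].
    have [YZ|ZY] := Ftot Y Z FY FZ.
      by exists Z => //; have [_ + _ _] := FPx _ _ FZ Zy; apply=> //; apply: YZ.
    by exists Y => //; have [_ + _ _] := FPx _ _ FY Yx; apply=> //; apply: ZY.
  - by move=> w [Y FY Yw]; have [_ _ + _] := FPx _ _ FY Yw; apply.
  - by move=> v w w' [Y FY Yw]; have [_ _ _ AR] := FPx _ _ FY Yw; apply: AR Yw.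
have {}PA : partial A.
  case: PA => // A0; case: (Amax [set (0, 0)]).
    by rewrite A0; split=> // /(_ (0, 0) erefl).
  right; split=> //=; last 1 first.
  - move=> v w w' [-> ->] R0; have := R_lin (-1) R0 R0.
    by rewrite !scaleN1r !addNr.
  - by move=> c x y -> ->; rewrite !scaler0 !addr0.
  - by move=> w [].
have [A0 Alin Afun AR] := PA.
have Atot v : exists w, A (v, w).
  apply: contrapT => /forallNP/(extend PA)[B [PB AB]].
  by apply: (Amax B AB); right.
have [f fP] := boolp.choice Atot.
have f_lin : linear f.
  move=> c v v'; apply/eqP; rewrite -subr_eq0; apply/eqP/Afun.
  have /= := Alin (-1) _ _ (Alin c _ _ (fP v) (fP v')) (fP (c *: v + v')).
  by rewrite !scaleN1r addNr [- _ + _]addrC.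
pose f' := GRing.isLinear.Build k V W _ f f_lin.
pose F : {linear V -> W} := HB.pack f f'.
by exists F => v w; apply: AR; apply: fP.
Qed.

End LinearChoice.

(** * Extension of scalars *)

Section ScalarExtension.
Variables (k : comNzRingType) (T : comAlgType k) (V : lmodType k).

Definition scalar_ext : Type := (T : lmodType k) ⊗ V.
HB.instance Definition _ := GRing.Zmodule.on scalar_ext.

Definition ext_scale (q : T) (x : scalar_ext) : scalar_ext :=
  tlift (fun (a : T) v => (q * a) *t v) x.

Lemma bilin_ext_scale (q : T) : bilin (fun (a : T) (v : V) => (q * a) *t v).
Proof.
split=> [a c v v' | v c a a']; first by rewrite ptensDr ptensZr.
by rewrite mulrDr -scalerAr ptensDl ptensZl.
Qed.

Lemma ext_scaleE q a v : ext_scale q (a *t v) = (q * a) *t v.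
Proof. by rewrite /ext_scale (tliftE (bilin_ext_scale q)). Qed.

Lemma ext_scaleDr : right_distributive ext_scale +%R.
Proof.
move=> q x y; have := tlift_is_linear (bilin_ext_scale q) 1 x y.
by rewrite !scale1r.
Qed.

Lemma ext_scaleDl x : {morph ext_scale^~ x : a b / a + b}.
Proof.
move=> q r; elim/tens_ind: x => [a v | x y IHx IHy].
  by rewrite !ext_scaleE mulrDl ptensDl.
by rewrite !ext_scaleDr IHx IHy addrACA.
Qed.

Lemma ext_scaleA q r x : ext_scale q (ext_scale r x) = ext_scale (q * r) x.
Proof.
elim/tens_ind: x => [a v | x y IHx IHy]; first by rewrite !ext_scaleE mulrA.
by rewrite !ext_scaleDr IHx IHy.
Qed.

Lemma ext_scale1 : left_id 1 ext_scale.
Proof.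
elim/tens_ind=> [a v | x y IHx IHy]; first by rewrite ext_scaleE mul1r.
by rewrite ext_scaleDr IHx IHy.
Qed.

HB.instance Definition _ := GRing.Zmodule_isLmodule.Build T scalar_ext
  ext_scaleA ext_scale1 ext_scaleDr ext_scaleDl.

End ScalarExtension.

Section Counit.
Variables (k : comNzRingType) (T : comAlgType k) (P : lmodType T).
Local Notation Pk := (pullback (in_alg T) P).

Lemma pullback_algE (c : k) (v : Pk) : c *: v = c%:A *: (v : P).
Proof. by []. Qed.

Lemma bilin_action : bilin (fun (q : T) (v : Pk) => (q *: (v : P) : Pk)).
Proof.
split=> [q c v v' | v c q q']; rewrite !pullback_algE.
  by rewrite scalerDr !scalerA mulrC.
by rewrite scalerDl scalerA mulr_algl.
Qed.

(** The counit of the adjunction between extension and restriction of scalars. *)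
Definition ext_counit : scalar_ext T Pk -> P :=
  tlift (fun (q : T) (v : Pk) => (q *: (v : P) : Pk)).

Lemma ext_counitE q v : ext_counit (q *t v) = q *: (v : P).
Proof. exact: (tliftE bilin_action). Qed.

Lemma ext_counit_is_linear : linear ext_counit.
Proof.
have cD x y : ext_counit (x + y) = ext_counit x + ext_counit y.
  by have := tlift_is_linear bilin_action 1 x y; rewrite !scale1r.
move=> q x y; rewrite cD; congr (_ + _).
elim/tens_ind: x => [a v | x x' IHx IHx'].
  by rewrite [q *: _]ext_scaleE !ext_counitE scalerA.
by rewrite scalerDr !cD IHx IHx' scalerDr.
Qed.

HB.instance Definition _ := GRing.isLinear.Build T (scalar_ext T Pk) P _
  ext_counit ext_counit_is_linear.

End Counit.

(** * Projective modules over truncated polynomials *)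

Section TruncatedPolynomials.
Variables (k : fieldType) (p : nat).
Hypothesis p_gt0 : (0 < p)%N.
Local Notation T := (truncpoly k p).
Local Notation t := ('qX : T).

Let mk_monicXp : mk_monic ('X^p : {poly k}) = 'X^p.
Proof. by rewrite mk_monic_Xn prednK. Qed.

Lemma qX_exp : t ^+ p = 0.
Proof.
apply/val_inj; rewrite -rmorphXn /= mk_monicXp.
by rewrite Pdiv.RingMonic.rmodpp ?monicXn.
Qed.

Lemma qpoly_sum_qX (q : T) : q = \sum_(i < p) q`_i *: t ^+ i.
Proof.
have sq : (size (val q) <= p)%N.
  have /leq_trans-> // := size_npoly q.
  by rewrite mk_monicXp size_polyXn.
have qE : q = in_qpoly 'X^p (val q).
  by apply/val_inj; exact/esym/in_qpoly_small/size_mk_monic.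
have sumE : val q = \sum_(i < p) q`_i *: 'X^i.
  rewrite -[LHS]coefK poly_def (big_ord_widen _ (fun i => q`_i *: 'X^i) sq).
  rewrite big_mkcond; apply: eq_bigr => i _; case: ltnP => // /(nth_default 0).
  by move=> /= ->; rewrite scale0r.
rewrite [LHS]qE [in LHS]sumE linear_sum; apply: eq_bigr => i _.
by rewrite linearZ /= rmorphXn.
Qed.

Lemma coef_qX i j : (i < p)%N -> (val (t ^+ i))`_j = (j == i)%:R.
Proof.
move=> ip; suff -> : val (t ^+ i) = 'X^i by rewrite coefXn.
rewrite -rmorphXn; apply: in_qpoly_small.
by rewrite mk_monicXp !size_polyXn ltnS.
Qed.

Lemma qX_linear (P N : lmodType T) (h : P -> N) :
    {morph h : v w / v + w} -> (forall (c : k) v, h (c%:A *: v) = c%:A *: h v) ->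
    (forall v, h (t *: v) = t *: h v) ->
  linear h.
Proof.
move=> hD hk ht q v w; rewrite hD; congr (_ + _).
have h0 : h 0 = 0 by apply: (@addrI _ (h 0)); rewrite -hD !addr0.
rewrite [q]qpoly_sum_qX !scaler_suml (big_morph h hD h0); apply: eq_bigr => i _.
rewrite -mulr_algl -!scalerA hk; congr (_ *: _).
elim: (i : nat) => [|j IHj]; first by rewrite !scale1r.
by rewrite exprS -!scalerA ht IHj.
Qed.

Lemma coef_mul_qX (a : T) j : (j.+1 < p)%N -> (t * a)`_j.+1 = a`_j.
Proof.
move=> jp; have -> : t * a = \sum_(i < p) a`_i *: t ^+ i.+1.
  rewrite [a in LHS]qpoly_sum_qX mulr_sumr; apply: eq_bigr => i _.
  by rewrite -scalerAr -exprS.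
rewrite poly_of_qpoly_sum coef_sum (bigD1 (Ordinal (ltnW jp))) //.
rewrite big1 => [|i /negPf ij].
  by rewrite [LHS]addr0 coefZ coef_qX // eqxx mulr1.
rewrite coefZ; have [ip|pi] := ltnP i.+1 p.
  rewrite coef_qX // eqSS -[j]/(val (Ordinal (ltnW jp))) eq_sym val_eqE ij.
  by rewrite mulr0.
have -> : i.+1 = p by apply/eqP; rewrite eqn_leq pi ltn_ord.
by rewrite qX_exp coef0 mulr0.
Qed.

Section Transfer.
Variables (P N : lmodType T).
Variable phi : {linear pullback (in_alg T) P -> pullback (in_alg T) N}.

(** The trace of a k-linear map, as for cyclic p-groups: multiplying by t on
either side shifts the sum by one place, and the term lost contains t^p. *)
Definition transfer (v : P) : N :=
  \sum_(i < p.-1.+1) t ^+ i *: (phi (t ^+ (p.-1 - i) *: v) : N).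

Lemma transfer_is_linear : linear transfer.
Proof.
have phiZ (c : k) (v : P) : phi (c%:A *: v) = c%:A *: (phi v : N).
  exact: (linearZ_LR phi c v).
apply: qX_linear => [v w | c v | v]; rewrite /transfer.
- rewrite -big_split; apply: eq_bigr => i _ /=.
  by rewrite scalerDr raddfD scalerDr.
- rewrite scaler_sumr; apply: eq_bigr => i _.
  by rewrite [in LHS]scalerA mulrC -[in LHS]scalerA phiZ !scalerA mulrC.
- rewrite big_ord_recl [in RHS]big_ord_recr /= subn0 subnn scalerA -exprSr.
  rewrite prednK // qX_exp scale0r raddf0 scaler0 add0r scalerDr scalerA -exprS.
  rewrite prednK // qX_exp scale0r addr0 scaler_sumr; apply: eq_bigr => i _.
  rewrite !scalerA -exprS -exprSr.
  by rewrite /bump add1n subnSK.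
Qed.

HB.instance Definition _ := GRing.isLinear.Build T P N _
  transfer transfer_is_linear.

End Transfer.

(** Every x is the sum of the t^i ⊗ c_i(x), and c_(i+1)(t x) = c_i(x); so t x = 0
leaves only the term of index p - 1. *)
Lemma scalar_ext_acyclic (V : lmodType k) : acyclic p (scalar_ext T V) t.
Proof.
pose c i (x : scalar_ext T V) : V := tlift (fun (a : T) v => a`_i *: v) x.
have c_bilin i : bilin (fun (a : T) (v : V) => a`_i *: v).
  split=> [a d v v' | v d a a']; first by rewrite scalerDr !scalerA mulrC.
  by rewrite coefD coefZ scalerDl scalerA.
have cE i a v : c i (a *t v) = a`_i *: v by exact: tliftE (c_bilin i) _ _.
have cD i x y : c i (x + y) = c i x + c i y.
  by have := tlift_is_linear (c_bilin i) 1 x y; rewrite !scale1r.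
have xE (x : scalar_ext T V) : x = \sum_(i < p) (t ^+ i) *t (c i x).
  elim/tens_ind: x => [a v | x y IHx IHy].
    rewrite [a in LHS]qpoly_sum_qX ptens_suml; apply: eq_bigr => i _.
    by rewrite cE ptensZl ptensZr.
  rewrite {1}IHx {1}IHy -big_split; apply: eq_bigr => i _.
  by rewrite cD ptensDr.
have cS x i : (i.+1 < p)%N -> c i.+1 (t *: x) = c i x.
  move=> ip; elim/tens_ind: x => [a v | x y IHx IHy].
    by rewrite [t *: _]ext_scaleE !cE coef_mul_qX.
  by rewrite scalerDr !cD IHx IHy.
move=> x tx; exists (1 *t c p.-1 x); rewrite [RHS]ext_scaleE mulr1 {1}[x]xE.
have lastp : (p.-1 < p)%N by rewrite prednK.
rewrite (bigD1 (Ordinal lastp)) //= big1 ?addr0 // => i /negPf ip.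
have {}ip : (i.+1 < p)%N.
  rewrite ltn_neqAle ltn_ord andbT; apply: contraFneq ip => pE.
  by rewrite -val_eqE /= -[p in p.-1]pE.
rewrite -cS // tx.
by rewrite -[c _ 0](addrK (c i.+1 0)) -cD addr0 subrr raddf0.
Qed.

(** A projective P is a retract of T ⊗ P, and the condition passes to retracts. *)
Lemma projective_acyclic (P : lmodType T) : projective P -> acyclic p P t.
Proof.
have sur (v : P) : exists x, ext_counit x = v.
  by exists ((1 : T) *t (v : pullback (in_alg T) P)); rewrite ext_counitE scale1r.
move=> /(_ _ _ (@ext_counit _ _ P) idfun sur)[h hP] v tv.
have [|w hw] := @scalar_ext_acyclic _ (h v); first by rewrite -linearZ tv linear0.
by exists (ext_counit w); rewrite -linearZ -hw hP.
Qed.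

(** Choose a k-linear psi with t^(p-1) psi = id on ker t.  Its transfer u is
T-linear and is the identity on ker t, where only the term of index p - 1
survives.  Given f : P -> Q and g : N -> Q onto, with k-linear section sec, the
transfer h0 of sec f psi satisfies g h0 = f u.  As 1 - u kills ker t, it maps
ker t^(j+1) into ker t^j, so it is nilpotent, and f is the sum of the
f u (1 - u)^j, each of which lifts as h0 (1 - u)^j. *)
Lemma acyclic_projective (P : lmodType T) : acyclic p P t -> projective P.
Proof.
move=> tP N Q g f g_surj.
pose Pk : lmodType k := pullback (in_alg T) P.
pose Qk : lmodType k := pullback (in_alg T) Q.
pose Nk : lmodType k := pullback (in_alg T) N.
have [psi psiP] : exists psi : {linear Pk -> Pk},
    forall v : P, t *: v = 0 -> t ^+ p.-1 *: (psi v : P) = v.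
  have [|psi psiP] := @linear_choice k Pk Pk
      (fun v w => t *: (v : P) = 0 /\ t ^+ p.-1 *: (w : P) = v).
    move=> c v w v' w' [tv vE] [tv' vE']; split.
      apply: etrans ((bilin_action P).1 t c v v') _.
      by rewrite tv tv' scaler0 addr0.
    by apply: etrans ((bilin_action P).1 _ c w w') _; rewrite vE vE'.
  exists psi => v tv; have [w vE] := tP v tv.
  by have [] := psiP v w (conj tv (esym vE)).
have [sec secP] : exists sec : {linear Qk -> Nk},
    forall q : Q, g (sec q) = q.
  have [|sec secP] := @linear_choice k Qk Nk (fun q n => g n = q).
    by move=> c q n q' n' <- <-; apply: linearP.
  by exists sec => q; have [n <-] := g_surj q; apply: secP.
have lift_lin : linear (fun v : Pk => sec (f (psi v : P)) : Nk).
  move=> c v w; rewrite [psi _]linearP.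
  have -> : f (c *: psi v + psi w) = c%:A *: f (psi v) + f (psi w).
    exact: (linearP f c%:A).
  exact: (linearP sec c).
pose lift_mixin := GRing.isLinear.Build k _ _ _ _ lift_lin.
pose lift : {linear Pk -> Nk} :=
  HB.pack (fun v : Pk => sec (f (psi v : P))) lift_mixin.
pose u : {linear P -> P} := transfer psi.
pose h0 : {linear P -> N} := transfer lift.
have gh0 v : g (h0 v) = f (u v).
  rewrite !linear_sum; apply: eq_bigr => i _; rewrite !linearZ /=.
  by rewrite secP.
have u_soc v : t *: v = 0 -> u v = v.
  move=> tv; rewrite /u /= /transfer big_ord_recr /= subnn scale1r psiP //.
  rewrite big1 ?add0r // => i _.
  by rewrite -subnSK // exprSr -scalerA tv scaler0 raddf0 scaler0.
have [h [e [hP eP]]] : exists h : {linear P -> N}, exists e : {linear P -> P},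
    (forall v, f v = g (h v) + f (e v)) /\ forall v, t ^+ (p - p) *: e v = 0.
  (* h is the partial sum of the h0 (1 - u)^i for i < j, and e is (1 - u)^j. *)
  suff H j : (j <= p)%N -> exists h : {linear P -> N}, exists e : {linear P -> P},
      (forall v, f v = g (h v) + f (e v)) /\ forall v, t ^+ (p - j) *: e v = 0.
    exact: H.
  elim: j => [_ | j IHj jp].
    exists (\0 : {linear P -> N}), (idfun : {linear P -> P}); split=> v /=.
      by rewrite linear0 add0r.
    by rewrite subn0 qX_exp scale0r.
  have [h [e [hP eP]]] := IHj (ltnW jp).
  exists (h \+ (h0 \o e)), (e \- (u \o e)); split=> v /=.
    by rewrite hP linearD gh0 linearB -addrA [_ + (_ - _)]addrCA subrr addr0.
  have socle : t *: (t ^+ (p - j.+1) *: e v) = 0 by rewrite scalerA -exprS subnSK.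
  have uE := linearZ_LR u (t ^+ (p - j.+1)) (e v).
  by rewrite scalerBr -uE u_soc ?subrr.
exists h => v; have := eP v; rewrite subnn scale1r => ev.
by rewrite [RHS]hP ev linear0 addr0.
Qed.

End TruncatedPolynomials.

(** * Sums of products of p-nilpotent elements *)

Definition nilprod_sum (p : nat) (B : pzRingType) (z : B) : Prop :=
  exists s : seq (B * B),
    all (fun ab => (ab.1 ^+ p == 0) && (ab.2 ^+ p == 0)) s /\
    z = \sum_(ab <- s) ab.1 * ab.2.

Section NilprodSum.
Variables (p : nat) (B : pzRingType).
Implicit Types y z : B.

Lemma nilprod_sum0 : nilprod_sum p (0 : B).
Proof. by exists [::]; rewrite big_nil. Qed.

Lemma nilprod_sumM (a b : B) : a ^+ p = 0 -> b ^+ p = 0 -> nilprod_sum p (a * b).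
Proof. by move=> ap bp; exists [:: (a, b)]; rewrite big_seq1 /= ap bp eqxx. Qed.

Lemma nilprod_sumD y z :
  nilprod_sum p y -> nilprod_sum p z -> nilprod_sum p (y + z).
Proof.
by move=> [s [sP ->]] [r [rP ->]]; exists (s ++ r); rewrite all_cat sP rP big_cat.
Qed.

Lemma nilprod_sumN z : nilprod_sum p z -> nilprod_sum p (- z).
Proof.
move=> [s [sP ->]]; exists [seq (- ab.1, ab.2) | ab <- s]; split.
  rewrite all_map; apply: sub_all sP => ab /= /andP[/eqP a0 ->].
  by rewrite exprNn a0 mulr0 eqxx.
by rewrite big_map -sumrN; apply: eq_bigr => ab _; rewrite mulNr.
Qed.

Lemma nilprod_sum_big (I : eqType) (r : seq I) (F : I -> B) :
  (forall i, i \in r -> nilprod_sum p (F i)) -> nilprod_sum p (\sum_(i <- r) F i).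
Proof.
move=> FP; rewrite big_seq; apply: big_ind => //; first exact: nilprod_sum0.
exact: nilprod_sumD.
Qed.

End NilprodSum.

Lemma acyclic_perturb_sum (p : nat) (B : comNzRingType) (N : lmodType B) (x z : B) :
    p \in [pchar B] -> x ^+ p = 0 -> nilprod_sum p z ->
  acyclic p N x -> acyclic p N (x + z).
Proof.
move=> pB xp [s [sP ->]]; elim: s x xp sP => [|[a b] s IHs] x xp /=.
  by rewrite big_nil addr0.
move=> /andP[/andP[/eqP ap /eqP bp] sP] xN; rewrite big_cons addrA /=.
apply: IHs => //; last exact: acyclic_perturb.
have := pFrobenius_autD_comm pB (mulrC x (a * b)).
by rewrite !pFrobenius_autE exprMn ap mul0r addr0 xp.
Qed.

(** The condition is symmetric in f and f', so that one implication suffices.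
The module structure lives over an algebra with a commutativity proof, which is
first packed as a commutative ring to apply the perturbation lemma. *)
Lemma projective_perturb (k : fieldType) (p : nat) (B : falgType k)
    (N : lmodType B) (f f' : {rmorphism truncpoly k p -> B}) :
    p \in [pchar k] -> commutative (@GRing.mul B) ->
    nilprod_sum p (f 'qX - f' 'qX) ->
  projective (pullback f N) <-> projective (pullback f' N).
Proof.
move=> pk BC; have p_gt0 := prime_gt0 (pcharf_prime pk).
suff H (g g' : {rmorphism truncpoly k p -> B}) : nilprod_sum p (g' 'qX - g 'qX) ->
    projective (pullback g N) -> projective (pullback g' N).
  by move=> ff'; split; apply: H => //; rewrite -opprB; apply: nilprod_sumN.
move=> gg' /(projective_acyclic p_gt0) gN; apply: (acyclic_projective p_gt0).
pose C : comNzRingType := HB.pack B (GRing.PzRing_hasCommutativeMul.Build B BC).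
have pC : p \in [pchar C] by rewrite (pchar_lalg B).
have gX (h : {rmorphism truncpoly k p -> B}) : h 'qX ^+ p = 0.
  by rewrite -rmorphXn qX_exp ?rmorph0 //.
have pullX (h : {rmorphism truncpoly k p -> B}) :
    acyclic p (pullback h N) 'qX <-> @acyclic p C N (h 'qX).
  have hX (w : N) : h ('qX ^+ p.-1) *: w = h 'qX ^+ p.-1 *: w.
    by rewrite rmorphXn.
  by split=> hN n /hN[w ->]; exists w; [exact: hX | exact/esym/hX].
apply/pullX; rewrite -[X in acyclic _ _ X](subrK (g 'qX)) addrC.
by apply: (acyclic_perturb_sum pC (gX g) gg'); exact/pullX.
Qed.

(** Otherwise 1 = u + b x with u in m, and u divides (b x)^n - 1 = - 1. *)
Lemma nilpotent_maximal (k : fieldType) (A : falgType k) (m : {pred A}) (x : A) n :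
    commutative (@GRing.mul A) -> maximal_ideal m -> x ^+ n = 0 -> x \in m.
Proof.
move=> AC [[m0 m1 mD] max] xn.
have mM a u : u \in m -> a * u \in m by move=> um; rewrite -[_ * _]addr0 mD.
pose J : {pred A} := fun z => `[< exists u b, u \in m /\ z = u + b * x >].
have JP z : reflect (exists u b, u \in m /\ z = u + b * x) (z \in J).
  exact: asboolP.
have mJ : {subset m <= J}.
  by move=> u um; apply/JP; exists u, 0; rewrite mul0r addr0.
apply: (max J) => //; last by apply/JP; exists 0, 1; rewrite add0r mul1r.
split; first exact: mJ.
  apply/JP => -[u [b [um oneE]]]; move/negP: m1; apply.
  have bx0 : (b * x) ^+ n = 0 by rewrite exprMn_comm ?xn ?mulr0 //; exact: AC.
  have := subrX1 (b * x) n; rewrite bx0 sub0r.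
  rewrite (_ : b * x - 1 = - u); last by rewrite oneE opprD addrCA subrr addr0.
  by rewrite mulNr => /oppr_inj->; rewrite [u * _]AC mM.
move=> a _ _ /JP[u [b [um ->]]] /JP[v [c [vm ->]]]; apply/JP.
exists (a * u + v), (a * b + c); split; first exact: mD.
by rewrite mulrDr mulrDl mulrA addrACA.
Qed.

(** * Comparing the two coproducts *)

Lemma tens_mulC (k : fieldType) (A B : falgType k) :
    commutative (@GRing.mul A) -> commutative (@GRing.mul B) ->
  commutative (@GRing.mul (A ⊗ B)).
Proof.
move=> AC BC x y; elim/tens_ind: x => [a b | x x' IHx IHx']; last first.
  by rewrite mulrDl mulrDr IHx IHx'.
elim/tens_ind: y => [c d | y y' IHy IHy']; last first.
  by rewrite mulrDl mulrDr IHy IHy'.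
by rewrite !ptensM AC BC.
Qed.

Lemma ptensX (k : fieldType) (A B : falgType k) (a : A) (b : B) n :
  (a *t b) ^+ n = (a ^+ n) *t (b ^+ n).
Proof. by elim: n => [//|n IHn]; rewrite !exprS IHn ptensM. Qed.

Lemma ptens0l (R : comNzRingType) (U V : lmodType R) (v : V) : (0 : U) *t v = 0.
Proof. exact: (bilin0l (bilin_ptens U V)). Qed.

Lemma ptensBl (R : comNzRingType) (U V : lmodType R) (u u' : U) (v : V) :
  (u - u') *t v = u *t v - u' *t v.
Proof. by rewrite -[- u']scaleN1r ptensDl ptensZl scaleN1r. Qed.

Lemma nilprod_sum_ptens (k : fieldType) (A B : falgType k) p (a : A) (b : B) :
  a ^+ p = 0 -> b ^+ p = 0 -> nilprod_sum p (a *t b).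
Proof.
move=> ap bp; rewrite -[a]mulr1 -[b]mul1r -ptensM.
by apply: nilprod_sumM; rewrite ptensX ?ap ?bp ?ptens0l ?linear0.
Qed.

Section MaximalTensors.
Variables (k : fieldType) (p : nat) (A : falgType k) (m : {pred A}).
Hypothesis m_exp : forall a : A, a \in m -> a ^+ p = 0.

Lemma in_tens_nilprod (x : A ⊗ A) : in_tens m m x -> nilprod_sum p x.
Proof.
move=> [s [/allP sm ->]]; apply: nilprod_sum_big => -[a b] /sm /andP[am bm].
by apply: nilprod_sum_ptens; apply: m_exp.
Qed.

(** On pure tensors the value is (u ⊗ h) ⊗ (v ⊗ h') with u and v in m,
and (u ⊗ h)^p = u^p ⊗ h^p. *)
Lemma in_tens_interchange (H : falgType k) (x : A ⊗ A) (y : H ⊗ H) :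
  in_tens m m x -> nilprod_sum p (tinterchange (x *t y)).
Proof.
move=> [s [/allP sm ->]]; rewrite ptens_suml linear_sum.
apply: nilprod_sum_big => -[a b] /sm /andP[/= am bm].
elim/tens_ind: y => [c d | y y' IHy IHy']; last first.
  by rewrite ptensDr linearD; apply: nilprod_sumD.
rewrite tinterchangeE; apply: nilprod_sum_ptens.
  by rewrite ptensX m_exp ?ptens0l.
by rewrite ptensX m_exp ?ptens0l.
Qed.

Variables D D' : {lrmorphism A -> A ⊗ A}.
Hypothesis D_prim : forall a, a \in m -> in_tens m m (D a - a *t 1 - 1 *t a).
Hypothesis D'_prim : forall a, a \in m -> in_tens m m (D' a - a *t 1 - 1 *t a).

Let DD' a : D a - D' a =
  (D a - a *t 1 - 1 *t a) - (D' a - a *t 1 - 1 *t a).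
Proof.
have subK (x y u : A ⊗ A) : (x - u) - (y - u) = x - y.
  by rewrite opprB addrA subrK.
by rewrite !subK.
Qed.

Lemma coprod_sub_nilprod a : a \in m -> nilprod_sum p (D a - D' a).
Proof.
move=> am; rewrite DD'; apply: nilprod_sumD; last apply: nilprod_sumN;
  by apply: in_tens_nilprod; auto.
Qed.

(** Write a = c + a' with c a scalar and a' in m.  Coproducts preserve scalars,
so on a ⊗ h the difference is the interchange of (D a' - D' a') ⊗ DH h. *)
Lemma tens_coprod_sub_nilprod (H : falgType k) (DH : {lrmorphism H -> H ⊗ H})
    (z : A ⊗ H) :
  trivial_residue_field m ->
  nilprod_sum p (tens_coprod D DH z - tens_coprod D' DH z).
Proof.
move=> km; elim/tens_ind: z => [a h | z z' IHz IHz']; last first.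
  by rewrite !linearD addrACA; apply: nilprod_sumD.
rewrite /tens_coprod /= !tens_mapE -linearB -ptensBl.
have [c cm] := km a.
have -> : D a - D' a = D (a - c%:A) - D' (a - c%:A).
  have EB (E : {lrmorphism A -> A ⊗ A}) : E (a - c%:A) = E a - c%:A.
    by rewrite linearB linearZ_LR rmorph1.
  by rewrite !EB opprB addrA subrK.
rewrite DD' ptensBl linearB.
by apply: nilprod_sumD; last apply: nilprod_sumN;
  apply: in_tens_interchange; auto.
Qed.

End MaximalTensors.

Theorem proposition4p2 (k : fieldType) (p : nat) (hp : p \in [pchar k])
    (A : falgType k) (hAC : commutative (@GRing.mul A))
    (m : {pred A}) (hm : local_with m)
    (hmp : forall a : A, a \in m -> a ^+ p = 0)
    (D D' : {lrmorphism A -> A ⊗ A})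
    (hD : forall a : A, a \in m -> in_tens m m (D a - a *t 1 - 1 *t a))
    (hD' : forall a : A, a \in m -> in_tens m m (D' a - a *t 1 - 1 *t a)) :
  (forall (M M' : lmodType A) (alpha : {lrmorphism truncpoly k p -> A}),
     flat_map alpha ->
     projective (pullback (D \o alpha) (M ⊠ M')) <->
     projective (pullback (D' \o alpha) (M ⊠ M')))
  /\
  (trivial_residue_field m ->
   forall (H : falgType k) (hHC : commutative (@GRing.mul H))
     (hopfH : hopf H) (mH : {pred H}) (hmH : local_with mH)
     (hmHp : forall c : H, c \in mH -> c ^+ p = 0)
     (M M' : lmodType (A ⊗ H)%type)
     (alpha : {lrmorphism truncpoly k p -> A ⊗ H}),
     flat_map alpha ->
     projective
       (pullback (tens_coprod D (hopf_coprod hopfH) \o alpha) (M ⊠ M')) <->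
     projective
       (pullback (tens_coprod D' (hopf_coprod hopfH) \o alpha) (M ⊠ M'))).
Proof.
have p_gt0 := prime_gt0 (pcharf_prime hp).
split=> [M M' alpha _ | km H hHC hopfH mH _ _ M M' alpha _].
  apply: projective_perturb => //; first exact: tens_mulC.
  apply: (coprod_sub_nilprod hmp hD hD').
  apply: (nilpotent_maximal (n := p) hAC hm.1).
  by rewrite -rmorphXn qX_exp ?rmorph0.
apply: (@projective_perturb k p _ (M ⊠ M')
  (tens_coprod D (hopf_coprod hopfH) \o alpha)
  (tens_coprod D' (hopf_coprod hopfH) \o alpha)) => //.
  by apply: tens_mulC; apply: tens_mulC.
exact: (tens_coprod_sub_nilprod hmp hD hD').
Qed.
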